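(* Let $\alpha, A, B$ be real constants with $\alpha\neq 0$, $B\ne 0$, and $\left|\frac{A}{\alpha}\right|>1$. Let $a,b,c,d$ be nonzero real numbers and consider the (well-defined) solution $(x_n)_{n=-3}^\infty$ of $$x_{n+1}=\frac{\alpha x_{n-3}}{A+B x_{n-1}x_{n-3}},\qquad n\ge 0,$$ with initial data $x_{-3}=d$, $x_{-2}=c$, $x_{-1}=b$, $x_0=a$. Then: 1. If $A-\alpha+Bbd\neq 0$ and $A-\alpha+Bac\neq 0$, then $(x_n)$ converges to zero. 2. If $A-\alpha+Bbd=0$ and $A-\alpha+Bac=0$, then $(x_n)$ converges to a number $l$ if and only if $a=b=c=d=l$.
   Context: A solution is a real sequence $(x_n)_{n\ge -3}$ with the given initial data satisfying the recurrence for all $n\ge 0$; it is understood to be well defined, i.e. the denominator $A+Bx_{n-1}x_{n-3}$ is nonzero for every $n\ge 0$. *)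

(* Defs.v *)
From Stdlib Require Import Reals.
Open Scope R_scope.

(* A sequence (x_n)_{n >= -3} is represented by u : nat -> R with u k = x_{k-3};
   thus x_{n-3}, x_{n-1}, x_{n+1} are u n, u (n + 2), u (n + 4). *)
Definition is_solution (alpha A B : R) (u : nat -> R) : Prop :=
  forall n : nat,
    A + B * u (n + 2)%nat * u n <> 0 /\
    u (n + 4)%nat = alpha * u n / (A + B * u (n + 2)%nat * u n).

(* x_{-3} = d, x_{-2} = c, x_{-1} = b, x_0 = a. *)
Definition has_initial_data (a b c d : R) (u : nat -> R) : Prop :=
  u 0%nat = d /\ u 1%nat = c /\ u 2%nat = b /\ u 3%nat = a.

(* Main.v *)
(** The products [p_n = x_{n-3} x_{n-1}] satisfy the Möbius recurrence
    [p_{n+2} = alpha p_n / (A + B p_n)], whose nonzero fixed point is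
    [(alpha - A) / B].  Off this fixed point, the coordinate
    [w = p / (A - alpha + B p)] conjugates the recurrence to multiplication by
    [q = alpha / A] with [|q| < 1], so [w_n -> 0]; hence the ratio
    [x_{n+1} / x_{n-3} = q (1 - B w) / (1 - B q w)] tends to [q] and [x_n -> 0].
    At the fixed point the ratio is [1], so the solution has period four. *)
Require Import Defs.
From Stdlib Require Import Reals Lra Lia Wf_nat.
Open Scope R_scope.

Lemma initial_segment_bounded (v : nat -> R) (k : nat) :
  exists M, 0 < M /\ forall n, (n < k)%nat -> Rabs (v n) <= M.
Proof.
  induction k as [|k [M [HM Hb]]].
  - exists 1. split; [lra | intros n Hn; lia].
  - exists (Rmax M (Rabs (v k))). split.
    + apply Rlt_le_trans with M; [exact HM | apply Rmax_l].
    + intros n Hn. destruct (Nat.eq_dec n k) as [-> | Hne].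
      * apply Rmax_r.
      * apply Rle_trans with M; [apply Hb; lia | apply Rmax_l].
Qed.

(** If [M] bounds the first [k] terms, each further block of [k] indices gains a factor [t], so the
    decay is geometric in the block number. *)
Lemma step_contraction_cv_0 (v : nat -> R) (k : nat) (t : R) :
  (0 < k)%nat -> 0 <= t < 1 ->
  (forall n, Rabs (v (n + k)%nat) <= t * Rabs (v n)) -> Un_cv v 0.
Proof.
  intros Hk Ht Hstep.
  destruct (initial_segment_bounded v k) as [M [HM Hb]].
  assert (Hbound : forall n, Rabs (v n) <= M).
  { intros n. induction n as [n IH] using lt_wf_ind.
    destruct (Nat.lt_ge_cases n k) as [Hn | Hn]; [now apply Hb |].
    replace n with (n - k + k)%nat by lia.
    specialize (IH (n - k)%nat ltac:(lia)).
    specialize (Hstep (n - k)%nat).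
    pose proof (Rabs_pos (v (n - k)%nat)). nra. }
  assert (Hdecay : forall j n, (k * j <= n)%nat -> Rabs (v n) <= M * t ^ j).
  { induction j as [|j IH]; intros n Hn.
    - simpl. rewrite Rmult_1_r. apply Hbound.
    - replace n with (n - k + k)%nat by lia.
      apply Rle_trans with (1 := Hstep (n - k)%nat).
      replace (M * t ^ S j) with (t * (M * t ^ j)) by (simpl; ring).
      apply Rmult_le_compat_l; [lra | apply IH; lia]. }
  intros eps Heps.
  destruct (pow_lt_1_zero t ltac:(rewrite Rabs_pos_eq; lra) (eps / M)
              ltac:(apply Rdiv_lt_0_compat; lra)) as [N HN].
  exists (k * N)%nat. intros n Hn. unfold Rdist. rewrite Rminus_0_r.
  apply Rle_lt_trans with (1 := Hdecay N n Hn).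
  specialize (HN N (le_n N)).
  pose proof (Rle_abs (t ^ N)).
  replace eps with (M * (eps / M)) by (field; lra).
  apply Rmult_lt_compat_l; lra.
Qed.

Lemma Un_cv_of_shift (v : nat -> R) (N : nat) (l : R) :
  Un_cv (fun n => v (n + N)%nat) l -> Un_cv v l.
Proof.
  intros H eps Heps. destruct (H eps Heps) as [K HK].
  exists (K + N)%nat. intros n Hn.
  replace n with (n - N + N)%nat by lia. apply HK. lia.
Qed.

(** The subsequence of step [k] starting at [n] is constantly [v n] and inherits the limit [l];
    limits are unique. *)
Lemma Un_cv_periodic (v : nat -> R) (k : nat) (l : R) :
  (0 < k)%nat -> (forall n, v (n + k)%nat = v n) -> Un_cv v l ->
  forall n, v n = l.
Proof.
  intros Hk Hper Hcv n.
  assert (Hmul : forall m, v (n + m * k)%nat = v n).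
  { induction m as [|m IH].
    - now rewrite Nat.add_0_r.
    - replace (n + S m * k)%nat with (n + m * k + k)%nat by lia.
      now rewrite Hper. }
  apply (UL_sequence (fun m => v (n + m * k)%nat)).
  - intros eps Heps. exists 0%nat. intros m _.
    rewrite Hmul. unfold Rdist. now rewrite Rminus_diag, Rabs_R0.
  - intros eps Heps. destruct (Hcv eps Heps) as [N HN].
    exists N. intros m Hm. apply HN. nia.
Qed.

Section Solution.

Variables (alpha A B : R) (x : nat -> R).
Hypothesis hx : is_solution alpha A B x.

Let p n := x (n + 2)%nat * x n.
Let Q n := A - alpha + B * p n.
Let q := alpha / A.
Let w n := p n / Q n.

Lemma denominator_neq_0 n : A + B * p n <> 0.
Proof.
  destruct (hx n) as [H _]. unfold p. now rewrite <- Rmult_assoc.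
Qed.

Lemma solution_step n : x (n + 4)%nat = alpha * x n / (A + B * p n).
Proof.
  destruct (hx n) as [_ H]. unfold p. now rewrite <- Rmult_assoc.
Qed.

(** Only the factor [x (n + 4)] is expanded; its numerator [x n] then joins [x (n + 2)] to rebuild
    [p n]. *)
Lemma product_step n : p (n + 2)%nat = alpha * p n / (A + B * p n).
Proof.
  unfold p at 1. replace (n + 2 + 2)%nat with (n + 4)%nat by lia.
  rewrite solution_step.
  unfold Rdiv, p. ring.
Qed.

Lemma deviation_step n : Q (n + 2)%nat = A * Q n / (A + B * p n).
Proof.
  unfold Q. rewrite product_step. field. apply denominator_neq_0.
Qed.

Lemma deviation_neq_0 :
  A <> 0 -> Q 0%nat <> 0 -> Q 1%nat <> 0 -> forall n, Q n <> 0.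
Proof.
  intros HA H0 H1 n.
  (* The recurrence for [Q] advances by two, so the induction carries two consecutive values. *)
  enough (Q n <> 0 /\ Q (S n) <> 0) by tauto.
  induction n as [|n [IH IH']]; [now split | split; [exact IH' |]].
  replace (S (S n)) with (n + 2)%nat by lia.
  rewrite deviation_step. pose proof (denominator_neq_0 n).
  unfold Rdiv. repeat apply Rmult_integral_contrapositive_currified; trivial.
  now apply Rinv_neq_0_compat.
Qed.

Lemma deviation_eq_0 :
  Q 0%nat = 0 -> Q 1%nat = 0 -> forall n, Q n = 0.
Proof.
  intros H0 H1 n.
  enough (Q n = 0 /\ Q (S n) = 0) by tauto.
  induction n as [|n [IH IH']]; [now split | split; [exact IH' |]].
  replace (S (S n)) with (n + 2)%nat by lia.
  rewrite deviation_step, IH. unfold Rdiv. ring.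
Qed.

(** One step multiplies [p] by [alpha] and [Q] by [A], over the same denominator, which cancels in
    [w]. *)
Lemma linearized_step n :
  A <> 0 -> Q n <> 0 -> w (n + 2)%nat = q * w n.
Proof.
  intros HA HQ. unfold w, q. rewrite deviation_step, product_step.
  field. repeat split; trivial. apply denominator_neq_0.
Qed.

(** Here [1 - B * w n = (A - alpha) / Q n] and [1 - B * q * w n = (A - alpha) * (A + B * p n) / (A *
    Q n)]. The cross-multiplied form avoids dividing by the latter. *)
Lemma solution_step_linearized n :
  A <> 0 -> Q n <> 0 ->
  x (n + 4)%nat * (1 - B * (q * w n)) = q * x n * (1 - B * w n).
Proof.
  intros HA HQ. rewrite solution_step. unfold w, q.
  pose proof (denominator_neq_0 n). unfold Q in *.
  field. repeat split; trivial.
Qed.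

Lemma solution_cv_0 :
  A <> 0 -> Rabs q < 1 -> Q 0%nat <> 0 -> Q 1%nat <> 0 -> Un_cv x 0.
Proof.
  intros HA Hq H0 H1.
  pose proof (deviation_neq_0 HA H0 H1) as HQ.
  pose proof (Rabs_pos q) as Hq0.
  assert (Hw : Un_cv (fun n => B * w n) 0).
  { apply (step_contraction_cv_0 _ 2 (Rabs q)); [lia | lra |].
    intros n. rewrite linearized_step; trivial.
    replace (B * (q * w n)) with (q * (B * w n)) by ring.
    rewrite Rabs_mult. apply Rle_refl. }
  (* With [|q| = 1 - 4 delta] and [|B w| < delta], the ratio is at most
     [(1 - 4 delta) (1 + delta) / (1 - delta) <= 1 - 2 delta]. *)
  set (delta := (1 - Rabs q) / 4).
  assert (Hdelta : 0 < delta) by (unfold delta; lra).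
  assert (Hqd : Rabs q = 1 - 4 * delta) by (unfold delta; lra).
  destruct (Hw delta Hdelta) as [N HN].
  apply (Un_cv_of_shift x N).
  apply (step_contraction_cv_0 _ 4 (1 - 2 * delta)); [lia | lra |].
  intros m. replace (m + 4 + N)%nat with (m + N + 4)%nat by lia.
  specialize (HN (m + N)%nat ltac:(lia)).
  unfold Rdist in HN. rewrite Rminus_0_r in HN.
  pose proof (solution_step_linearized (m + N) HA (HQ _)) as Hs.
  apply (f_equal Rabs) in Hs. rewrite !Rabs_mult in Hs.
  set (e := B * w (m + N)%nat) in *.
  replace (B * (q * w (m + N)%nat)) with (q * e) in Hs by (unfold e; ring).
  (* Since [Rabs q < 1], the term [q * e] is also smaller than [delta] in absolute value. *)
  assert (Hl : 1 - delta <= Rabs (1 - q * e)).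
  { pose proof (Rabs_triang_inv 1 (q * e)) as H.
    rewrite Rabs_R1, Rabs_mult in H.
    pose proof (Rabs_pos e). nra. }
  assert (Hr : Rabs (1 - e) <= 1 + delta).
  { pose proof (Rabs_triang 1 (- e)) as H.
    rewrite Rabs_R1, Rabs_Ropp in H. unfold Rminus. lra. }
  pose proof (Rabs_pos (x (m + N)%nat)) as Hx.
  pose proof (Rabs_pos (x (m + N + 4)%nat)) as Hx'.
  apply Rmult_le_reg_r with (1 - delta); [lra |].
  apply Rle_trans with (Rabs q * Rabs (x (m + N)%nat) * (1 + delta)).
  - apply Rle_trans with (Rabs q * Rabs (x (m + N)%nat) * Rabs (1 - e)).
    + rewrite <- Hs. now apply Rmult_le_compat_l.
    + apply Rmult_le_compat_l; [now apply Rmult_le_pos | exact Hr].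
  - rewrite Hqd.
    replace ((1 - 4 * delta) * Rabs (x (m + N)%nat) * (1 + delta))
      with (Rabs (x (m + N)%nat) * ((1 - 4 * delta) * (1 + delta))) by ring.
    replace ((1 - 2 * delta) * Rabs (x (m + N)%nat) * (1 - delta))
      with (Rabs (x (m + N)%nat) * ((1 - 2 * delta) * (1 - delta))) by ring.
    (* The right product exceeds the left one by [6 * delta ^ 2]. *)
    apply Rmult_le_compat_l; [exact Hx | nra].
Qed.

Lemma solution_periodic :
  alpha <> 0 -> Q 0%nat = 0 -> Q 1%nat = 0 ->
  forall n, x (n + 4)%nat = x n.
Proof.
  intros Halpha H0 H1 n. rewrite solution_step.
  pose proof (deviation_eq_0 H0 H1 n) as H. unfold Q in H.
  replace (A + B * p n) with alpha by lra. now field.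
Qed.

End Solution.

Theorem theorem3p1 (alpha A B : R) (halpha : alpha <> 0) (hB : B <> 0)
    (hA : Rabs (A / alpha) > 1)
    (a b c d : R) (ha : a <> 0) (hb : b <> 0) (hc : c <> 0) (hd : d <> 0)
    (x : nat -> R) (hx : is_solution alpha A B x)
    (hinit : has_initial_data a b c d x) :
  (A - alpha + B * b * d <> 0 -> A - alpha + B * a * c <> 0 -> Un_cv x 0) /\
  (A - alpha + B * b * d = 0 -> A - alpha + B * a * c = 0 ->
    forall l : R, Un_cv x l <-> (a = l /\ b = l /\ c = l /\ d = l)).
Proof.
  destruct hinit as (H0 & H1 & H2 & H3).
  (* In terms of [x], [b * d] and [a * c] become the products [p 0] and [p 1], so the two conditions
     concern [Q 0] and [Q 1]. *)
  rewrite <- H0, <- H1, <- H2, <- H3, !Rmult_assoc.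
  split.
  - assert (HA0 : A <> 0).
    { intros ->. unfold Rdiv in hA. rewrite Rmult_0_l, Rabs_R0 in hA. lra. }
    apply (solution_cv_0 alpha A B x hx HA0).
    replace (alpha / A) with (/ (A / alpha)) by (field; now split).
    rewrite Rabs_inv, <- Rinv_1. apply Rinv_lt_contravar; lra.
  - intros HQ0 HQ1 l.
    pose proof (solution_periodic alpha A B x hx halpha HQ0 HQ1) as Hper.
    split.
    + intros Hcv.
      pose proof (Un_cv_periodic x 4 l ltac:(lia) Hper Hcv) as H.
      now rewrite !H.
    + intros (E3 & E2 & E1 & E0).
      assert (Hconst : forall n, x n = l).
      { intros n. induction n as [n IH] using lt_wf_ind.
        (* The four base cases are the initial data; periodicity covers the rest. *)
        destruct n as [|[|[|[|n]]]]; trivial.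
        replace (S (S (S (S n)))) with (n + 4)%nat by lia.
        rewrite Hper. apply IH. lia. }
      intros eps Heps. exists 0%nat. intros n _.
      rewrite Hconst. unfold Rdist. now rewrite Rminus_diag, Rabs_R0.
Qed.
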